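(* There are infinitely many positive integers $n$ for which there exist a real number $C \ge 10$ and positive integers $A, B, a_1, a_2, b_1, b_2$ such that $$n = AB = (A + a_1)(B - b_1) = (A + a_2)(B - b_2),$$ $1 \le a_1 < a_2 \le C$, $1 \le b_1 < b_2 \le C$, and $$\max(A, B) \ge \tfrac{1}{4} C^3 - \tfrac{1}{2} C^2 + \tfrac{1}{4} C.$$ *)

(* Defs.v *)
From mathcomp Require Import all_boot all_order all_algebra.
From mathcomp Require Import boolp classical_sets cardinality reals.

(* Main.v *)
Require Import Defs.
From mathcomp Require Import all_boot all_order all_algebra.
From mathcomp Require Import boolp classical_sets cardinality reals.
From mathcomp Require Import zify ring lra.

Import Order.TTheory GRing.Theory Num.Theory.
Local Open Scope classical_set_scope.
Local Open Scope ring_scope.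

(** Expanding [A * B = (A + a) * (B - b)] gives the linear equation
    [a * B - b * A = a * b].  Two such equations, for [(a1, b1)] and [(a2, b2)],
    determine [A] and [B]: with [D = a2 * b1 - a1 * b2],
    [A = a1 * a2 * (b2 - b1) / D] and [B = b1 * b2 * (a2 - a1) / D].
    For [B] to have order [C ^ 3 / 4] one wants [D = 1], [a2] and [b2] close to
    [C], and [a1] and [b1] close to [C / 2].  With [C = 2 * k + 1], the choice
    [b2 = 2 * k + 1], [a2 = 2 * k - 1], [b1 = k], [a1 = k - 1] has [D = 1] and
    gives [B = (2 * k + 1) * k ^ 2], which is exactly [C * (C - 1) ^ 2 / 4],
    the required lower bound.  The product [A * B] increases strictly with [k]
    ([gridProduct_lt]), so infinitely many [n] arise. *)

(** The product [A * B] as a function of [k]. *)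
Definition gridProduct (k : int) : int :=
  ((k - 1) * (2 * k - 1) * (k + 1)) * ((2 * k + 1) * k ^+ 2).

Lemma gridProduct_lt (k l : int) : 1 <= k -> k < l ->
  gridProduct k < gridProduct l.
Proof.
(* In terms of the square [u = k ^ 2] the product is [u * (u - 1) * (4 * u - 1)],
   whose three factors are nonnegative and strictly increasing. *)
have prodE x : gridProduct x = x ^+ 2 * (x ^+ 2 - 1) * (4 * x ^+ 2 - 1).
  by rewrite /gridProduct; ring.
move=> k_ge1 lt_kl; rewrite !prodE.
have u_ge1 : 1 <= k ^+ 2 by nra.
have lt_uv : k ^+ 2 < l ^+ 2 by nra.
move: (k ^+ 2) (l ^+ 2) u_ge1 lt_uv => u v u_ge1 lt_uv.
by apply: ltr_pM; [nra | lia | apply: ltr_pM; lia | lia].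
Qed.

Theorem mainTheorem3 (R : realType) :
  infinite_set [set n : int | 0 < n /\
    exists (C : R) (A B a1 a2 b1 b2 : int),
      10 <= C /\
      (0 < A /\ 0 < B /\ 0 < a1 /\ 0 < a2 /\ 0 < b1 /\ 0 < b2) /\
      (n = A * B /\ n = (A + a1) * (B - b1) /\ n = (A + a2) * (B - b2)) /\
      (1 <= a1 /\ a1 < a2 /\ a2%:~R <= C) /\
      (1 <= b1 /\ b1 < b2 /\ b2%:~R <= C) /\
      1 / 4 * C ^+ 3 - 1 / 2 * C ^+ 2 + 1 / 4 * C <= (Num.max A B)%:~R].
Proof.
(* The condition [10 <= C = 2 * k + 1] holds from [k = 5] on. *)
pose f (m : nat) : int := gridProduct (m%:Z + 5).
have f_inj : injective f.
  move=> m p fmp; have [lt_mp|lt_pm|//] := ltngtP m p.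
  - suff : f m < f p by rewrite fmp ltxx.
    by apply: gridProduct_lt; lia.
  - suff : f p < f m by rewrite fmp ltxx.
    by apply: gridProduct_lt; lia.
apply: (@sub_infinite_set _ (range f)); last first.
  have range_card : (range f #= [set: nat])%card.
    by apply: inj_card_eq => m p _ _; apply: f_inj.
  by apply/infiniteP; move/card_eqPle: range_card => [].
move=> _ [m _ <-]; rewrite /f.
have k_ge5 : 5 <= m%:Z + 5 by lia.
move: (m%:Z + 5) k_ge5 => k k_ge5 {f f_inj m} /=.
pose A := (k - 1) * (2 * k - 1) * (k + 1).
pose B := (2 * k + 1) * k ^+ 2.
have A_gt0 : 0 < A by rewrite !mulr_gt0 //; lia.
have B_gt0 : 0 < B by rewrite mulr_gt0 ?exprn_gt0 //; lia.
split; first exact: mulr_gt0.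
exists (2 * k + 1)%:~R, A, B, (k - 1), (2 * k - 1), k, (2 * k + 1).
split; first by rewrite -[10]/(10%:~R) ler_int; lia.
split; first by do !split=> //; lia.
split; first by rewrite /gridProduct /A /B; do !split; ring.
split; first by rewrite ler_int; lia.
split; first by rewrite ler_int; lia.
apply: (@le_trans _ _ B%:~R); last by rewrite ler_int le_max lexx orbT.
rewrite le_eqVlt; apply/orP; left; apply/eqP.
rewrite /B !(rmorphM, rmorphD) /=.
by field.
Qed.
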